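(* Let $q$ be a prime power and let $n=\prod_i p_i^{m_i}>1$ be (the prime factorization, with all $m_i>0$, of) an odd integer with $\gcd(n,q)=1$ such that every $p_i\equiv -1 \pmod 4$. For each $i$, let $t_i=\mathrm{ord}_{p_i}q^2$ and let $z_i$ be the integer such that $p_i^{z_i}\,\|\,q^{2t_i}-1$. If $m_i>2z_i$ for all $i$, then there exist degenerate quantum codes with parameters $[[n,1,d]]_q$ that are pure to some $d'\le \min_i\{p_i^{z_i}\}<d$, and with $d^2-d+1\ge n$.
   Context: $\mathrm{ord}_N a$ denotes the multiplicative order of $a$ modulo $N$. $p^{z}\,\|\,M$ means that $p^{z}$ divides $M$ but $p^{z+1}$ does not. Quantum codes. Let $\{|x\rangle : x\in\mathbb{F}_q\}$ be an orthonormal basis of $\mathbb{C}^q$, let $\ell$ be the characteristic of $\mathbb{F}_q$, and $\omega=e^{2\pi i/\ell}$. For $a,b\in\mathbb{F}_q^n$ let $E_{a,b}$ be the operator on $(\mathbb{C}^q)^{\otimes n}$ equal to $\bigotimes_i X(a_i)Z(b_i)$, where $X(a)|x\rangle=|x+a\rangle$ and $Z(b)|x\rangle=\omega^{\mathrm{tr}(bx)}|x\rangle$ with $\mathrm{tr}:\mathbb{F}_q\to\mathbb{F}_\ell$ the trace; its weight is the number of $i$ with $(a_i,b_i)\ne(0,0)$. A quantum code with parameters $[[n,k,d]]_q$ (here $k\geq 1$) is a subspace of $(\mathbb{C}^q)^{\otimes n}$ of dimension $q^k$, with orthogonal projector $P$, such that $d$ is the largest integer for which every $E_{a,b}$ of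 weight less than $d$ satisfies $PE_{a,b}P=cP$ for some scalar $c$ (depending on $a,b$). The code is pure to $t$ if $PE_{a,b}P=0$ for all $E_{a,b}$ of weight between $1$ and $t-1$. It is pure if it is pure to $d$, and degenerate (impure) if it is not pure. *)

(* Defs.v *)
From HB Require Import structures.
From mathcomp Require Import all_boot all_order all_algebra all_fingroup.
From mathcomp Require Import all_solvable all_field.
From mathcomp Require Import reals trigo.
From mathcomp Require Import complex.

Set Implicit Arguments.
Unset Strict Implicit.
Unset Printing Implicit Defensive.
Import Order.TTheory GRing.Theory Num.Theory.
Local Open Scope ring_scope.

Definition is_mult_order (N a t : nat) : Prop :=
  [/\ (0 < t)%N, a ^ t = 1 %[mod N] &
      forall s, (0 < s)%N -> a ^ s = 1 %[mod N] -> (t <= s)%N].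

Definition exactly_divides (p z M : nat) : Prop :=
  (p ^ z %| M)%N /\ ~~ (p ^ z.+1 %| M)%N.

(* Minimum of f over the prime divisors of n.  For n > 1 the starting value is
   one of the terms, since [pdiv n] is the smallest element of [primes n]. *)
Definition min_over_primes (n : nat) (f : nat -> nat) : nat :=
  \big[minn/f (pdiv n)]_(p <- primes n) f p.

Definition fchar (F : finFieldType) : nat := s2val (finPcharP F).

Lemma fchar_pchar (F : finFieldType) : fchar F \in [pchar F].
Proof. exact: (s2valP' (finPcharP F)). Qed.

(* F as a Galois extension of its prime field. *)
Notation over_prime F := (pPrimeCharType (fchar_pchar F)).

(* [galTrace] takes its values in the line 'F_p.1 of F; this reads the result
   back as an element of 'F_p.  By [ftraceE] the default 0 is never used. *)
Definition ftrace (F : finFieldType) (x : F) : 'F_(fchar F) :=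
  odflt 0 [pick c : 'F_(fchar F) |
    c%:A == galTrace 1%AS {:over_prime F}%AS (x : over_prime F)].

Lemma ftraceE (F : finFieldType) (x : F) :
  (ftrace x)%:A = galTrace 1%AS {:over_prime F}%AS (x : over_prime F).
Proof.
rewrite /ftrace; case: pickP => [c /eqP //|no].
have gal1 : galois 1%AS {:over_prime F}%AS by exact: finField_galois (sub1v _).
have /vlineP[c Dc] := mem_galTrace gal1 (memvf (x : over_prime F)).
by move: (no c); rewrite Dc eqxx.
Qed.

Definition Cplx (R : realType) : numClosedFieldType := R[i].

(* The Hilbert space with orthonormal basis indexed by I, a vector being the
   family of its coordinates.  The n-fold tensor power of [qspace R F] is taken
   to be [qspace R 'rV[F]_n]. *)
Definition qspace (R : realType) (I : finType) : vectType (Cplx R) :=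
  {ffun I -> (Cplx R)^o}.

Section Operators.
Variables (R : realType) (I : finType).
Implicit Types (u v : qspace R I).

Definition ket (x : I) : qspace R I := [ffun y => (y == x)%:R].

Definition qdot u v : Cplx R := \sum_x (u x : Cplx R)^* * (v x : Cplx R).

(* The linear operator sending [ket x] to [phi x], see [op_on_basisE]. *)
Definition op_on_basis (phi : I -> qspace R I) : 'End(qspace R I) :=
  linfun (fun u : qspace R I => \sum_x (u x : Cplx R) *: phi x).

Lemma op_on_basisE (phi : I -> qspace R I) x : op_on_basis phi (ket x) = phi x.
Proof.
pose f u := \sum_y (u y : Cplx R) *: phi y.
have linf : linear f.
  move=> a u v; rewrite /f scaler_sumr -big_split; apply: eq_bigr => y _ /=.
  by rewrite !ffunE scalerDl scalerA.
pose lf := GRing.isLinear.Build (Cplx R) _ _ _ f linf.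
pose g : {linear qspace R I -> qspace R I} := HB.pack f lf.
have -> : op_on_basis phi = linfun g by [].
rewrite lfunE /= /f (bigD1 x) //= big1 => [|y yx]; rewrite !ffunE.
  by rewrite eqxx scale1r addr0.
by rewrite (negbTE yx) scale0r.
Qed.

Definition is_orthogonal_projector (Q : {vspace qspace R I})
    (P : 'End(qspace R I)) : Prop :=
  forall u, P u \in Q /\ forall v, v \in Q -> qdot v (u - P u) = 0.

End Operators.

Section Codes.
Variables (R : realType) (F : finFieldType).

(* e^(2 i pi / p), with p the characteristic of F *)
Definition omega : Cplx R :=
  let t := 2 * pi / (fchar F)%:R in Complex (cos t) (sin t).

Definition Xop (a : F) : 'End(qspace R F) :=
  op_on_basis (fun x => ket R (x + a)).

Definition Zop (b : F) : 'End(qspace R F) :=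
  op_on_basis (fun x => omega ^+ ftrace (b * x) *: ket R x).

Variable n : nat.

Definition tensor (v : 'I_n -> qspace R F) : qspace R 'rV[F]_n :=
  [ffun x : 'rV[F]_n => \prod_(i < n) (v i (x 0 i) : Cplx R)].

Definition tensor_op (A : 'I_n -> 'End(qspace R F)) :
    'End(qspace R 'rV[F]_n) :=
  op_on_basis (fun x : 'rV[F]_n => tensor (fun i => A i (ket R (x 0 i)))).

Definition Eop (a b : 'rV[F]_n) : 'End(qspace R 'rV[F]_n) :=
  tensor_op (fun i => (Xop (a 0 i) \o Zop (b 0 i))%VF).

Definition weight (a b : 'rV[F]_n) : nat :=
  #|[set i | (a 0 i, b 0 i) != (0, 0)]|.

Implicit Types (Q : {vspace qspace R 'rV[F]_n})
  (P : 'End(qspace R 'rV[F]_n)).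

Definition detects P (d : nat) : Prop :=
  forall a b : 'rV[F]_n, (weight a b < d)%N ->
    exists c : Cplx R, (P \o Eop a b \o P)%VF = c *: P.

(* Q, with orthogonal projector P, is an [[n,k,d]]_q code for q = #|F|. *)
Definition is_quantum_code (k d : nat) Q P : Prop :=
  [/\ (0 < k)%N, \dim Q = (#|F| ^ k)%N, is_orthogonal_projector Q P,
      detects P d & forall d0, detects P d0 -> (d0 <= d)%N].

Definition pure_to P (t : nat) : Prop :=
  forall a b : 'rV[F]_n, (0 < weight a b < t)%N ->
    (P \o Eop a b \o P)%VF = 0.

(* d stands for the minimum distance of the code. *)
Definition degenerate P (d : nat) : Prop := ~ pure_to P d.

End Codes.

(* Main.v *)
Require Import Defs.
From HB Require Import structures.
From mathcomp Require Import all_boot all_order all_algebra all_fingroup.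
From mathcomp Require Import all_solvable all_field.
From mathcomp Require Import reals trigo.
From mathcomp Require Import complex.
From mathcomp Require Import ring zify.

(* Concatenating the q-ary Shor code [[m^2,1,m]] with the q-ary five-qudit code
   [[5,1,3]] (the graph code of the pentagon) yields [[5m^2,1,3m]]_q codes for
   all m and q.  Adding ancillas in the state |0> pads the length to n without
   changing the distance, and makes the code degenerate, since a Z error on an
   ancilla has weight one and acts as the identity on the code.  Here p^3 | n for
   some odd prime p, so that n = 27 or n >= 81, and then some m satisfies
   5m^2 <= n - 1 <= 3m(3m - 1); this gives n <= d^2 - d + 1 for d >= 3m.  Finally
   p^(2z+1) | n forces p^z < sqrt n <= d. *)

Set Implicit Arguments.
Unset Strict Implicit.
Unset Printing Implicit Defensive.
Import Order.TTheory GRing.Theory Num.Theory.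
Local Open Scope ring_scope.

(** * Additive characters of a finite field *)

(** The character is [zt ^+ f x], for a linear form [f] over the prime field that is nonzero at 1
    and a nontrivial p-th root of unity [zt]. *)
Lemma additive_character (C : numClosedFieldType) (F : finFieldType) :
  exists chi : F -> C, [/\ forall x y, chi (x + y) = chi x * chi y,
    forall x, (chi x)^* * chi x = 1 & exists a, chi a != 1].
Proof.
have pr_p : prime (fchar F) by exact: (pcharf_prime (fchar_pchar F)).
set p := fchar F in pr_p *.
pose L := over_prime F.
have [f f1] : exists f : {linear L -> ('F_p)^o}, f (1 : L) != 0.
  have [i ci|c0] := pickP (fun i => coord (vbasis {:L}) i 1 != 0).
    by exists (coord (vbasis {:L}) i).
  have /eqP[] := oner_neq0 L; rewrite (coord_vbasis (memvf (1 : L))).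
  by rewrite big1 // => i _; have /negbFE/eqP-> := c0 i; rewrite scale0r.
(* A root of 1 + X + ... + X^(p-1); it differs from 1 because the value at 1 is p, nonzero in
   characteristic 0. *)
have [zt zt1 zp] : exists2 zt : C, zt != 1 & zt ^+ p = 1.
  have := closed_rootP (\sum_(i < p) 'X^i : {poly C}).
  have -> : size (\sum_(i < p) 'X^i : {poly C}) = p.
    have -> : \sum_(i < p) 'X^i = \poly_(i < p) (1 : C).
      by rewrite poly_def; apply: eq_bigr => i _; rewrite scale1r.
    by rewrite size_poly_eq // oner_eq0.
  rewrite gtn_eqF ?prime_gt1 // => /elimT/(_ isT)[zt].
  rewrite /root horner_sum => /eqP sum0.
  have {}sum0 : \sum_(i < p) zt ^+ i = 0.
    by rewrite -[RHS]sum0; apply: eq_bigr => i _; rewrite hornerXn.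
  exists zt; last first.
    by apply/eqP; rewrite -subr_eq0 subrX1 sum0 mulr0.
  apply: contra_eq_neq sum0 => ->.
  under eq_bigr do rewrite expr1n.
  by rewrite sumr_const card_ord pnatr_eq0 -lt0n prime_gt0.
exists (fun x => zt ^+ (f (x : L) : 'F_p)); split=> [x y|x|].
- rewrite (raddfD f x y) -exprD /= -[in RHS](expr_mod _ zp).
  by congr (_ ^+ (_ %% _)); exact: Fp_cast.
- have z1 : `|zt| = 1.
    by apply/eqP; rewrite -(pexpr_eq1 (prime_gt0 pr_p)) // -normrX zp normr1.
  by rewrite -normCKC normrX z1 !expr1n.
exists ((f (1 : L))^-1 *: (1 : L)).
have -> : f ((f (1 : L))^-1 *: (1 : L)) = 1 by rewrite linearZ; exact: mulVf.
by rewrite expr1.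
Qed.

(** * Matrix elements of product operators and error detection *)

Section Sandwich.
Variables (C : numClosedFieldType) (F : finFieldType).

(** The matrix element between [u] and [v] of the tensor product of the [A j], with [A j a b] the
    entry in row a and column b. *)
Definition sandwich (J : finType) (u v : {ffun J -> F} -> C)
    (A : J -> F -> F -> C) : C :=
  \sum_(x : {ffun J -> F}) \sum_(y : {ffun J -> F})
    (u x)^* * \prod_j A j (x j) (y j) * v y.

Definition scalar_at (J : finType) (A : J -> F -> F -> C) (j : J) : Prop :=
  exists c, forall a b, A j a b = c * (a == b)%:R.

Definition idop (J : finType) (j : J) (a b : F) : C := (a == b)%:R.

(** Off [S] the operators are diagonal, so only pairs x, y that agree off [S] contribute. *)
Lemma eq_sandwich (J : finType) (S : {set J}) (A : J -> F -> F -> C)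
    (u v u' v' : {ffun J -> F} -> C) :
  (forall j, j \notin S -> scalar_at A j) ->
  (forall x y : {ffun J -> F}, (forall j, j \notin S -> x j = y j) ->
     (u x)^* * v y = (u' x)^* * v' y) ->
  sandwich u v A = sandwich u' v' A.
Proof.
move=> scA uv; apply: eq_bigr => x _; apply: eq_bigr => y _.
have [/existsP[j /andP[jS xy]]|] :=
    boolP [exists j, (j \notin S) && (x j != y j)].
  rewrite (bigD1 j) //=; have [c ->] := scA j jS.
  by rewrite (negbTE xy) mulr0 mul0r !mulr0 !mul0r.
rewrite negb_exists => /forallP agree.
rewrite mulrAC [RHS]mulrAC; congr (_ * _); apply: uv => j jS.
by apply/eqP; move: (agree j); rewrite jS /= negbK.
Qed.

(** Translation by [w] acts only outside [S], where [A] is scalar, so it commutes with the product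
    operator. *)
Lemma sandwich_shift (J : finType) (S : {set J}) (A : J -> F -> F -> C)
    (u v : {ffun J -> F} -> C) (w : {ffun J -> F}) :
  (forall j, j \notin S -> scalar_at A j) -> (forall j, j \in S -> w j = 0) ->
  sandwich (fun x => u (x + w)) (fun y => v (y + w)) A = sandwich u v A.
Proof.
move=> scA w0; rewrite /sandwich [RHS](reindex_inj (addIr w)) /=.
apply: eq_bigr => x _; rewrite [RHS](reindex_inj (addIr w)) /=.
apply: eq_bigr => y _; congr (_ * _ * _); apply: eq_bigr => j _.
rewrite !ffunE; have [jS|jS] := boolP (j \in S); first by rewrite w0 ?addr0.
by have [c Ac] := scA j jS; rewrite !Ac (inj_eq (addIr _)).
Qed.

Lemma sandwich_id (J : finType) (u v : {ffun J -> F} -> C) :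
  sandwich u v (@idop J) = \sum_x (u x)^* * v x.
Proof.
apply: eq_bigr => x _; rewrite (bigD1 x) //= [X in _ + X]big1 => [|y yx].
  by rewrite addr0 big1 ?mulr1 // => j _; rewrite /idop eqxx.
have [j xy] : exists j, x j != y j.
  apply/existsP; rewrite -negb_forall; apply: contra yx => /forallP xy.
  by apply/eqP/ffunP => j; apply/esym/eqP.
by rewrite (bigD1 j) //= /idop (negbTE xy) mul0r mulr0 mul0r.
Qed.

Lemma sandwichZl (J : finType) a (u v : {ffun J -> F} -> C)
    (A : J -> F -> F -> C) :
  sandwich u (fun y => a * v y) A = a * sandwich u v A.
Proof.
rewrite /sandwich mulr_sumr; apply: eq_bigr => x _; rewrite mulr_sumr.
by apply: eq_bigr => y _; rewrite mulrCA.
Qed.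

Lemma sandwich_scale (J : finType) (u v : {ffun J -> F} -> C)
    (A B : J -> F -> F -> C) (c : J -> C) :
  (forall j a b, B j a b = c j * A j a b) ->
  sandwich u v B = (\prod_j c j) * sandwich u v A.
Proof.
move=> BA; rewrite /sandwich mulr_sumr; apply: eq_bigr => x _; rewrite mulr_sumr.
apply: eq_bigr => y _; under eq_bigr do rewrite BA.
by rewrite big_split /=; ring.
Qed.

(* Asking for all product operators instead of the errors [Eop a b] makes
   the condition stable under concatenation. *)
Definition detecting (J : finType) (d : nat)
    (phi : F -> {ffun J -> F} -> C) : Prop :=
  forall (S : {set J}) (A : J -> F -> F -> C), (#|S| < d)%N ->
    (forall j, j \notin S -> scalar_at A j) ->
  exists c, forall s t, sandwich (phi s) (phi t) A = c * (s == t)%:R.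

(* The last field says that an X-type error realizes a logical shift, which is
   undetectable; this bounds the minimum distance from above. *)
Record shift_code (J : finType) (d : nat) (phi : F -> {ffun J -> F} -> C) :
    Prop := ShiftCode {
  code_detecting : detecting d phi;
  code_neq0 : sandwich (phi 0) (phi 0) (@idop J) != 0;
  code_shift : exists w : J -> F,
    forall s c x, phi (s + c) (x + [ffun j => c * w j]) = phi s x }.

(** The two halves of the Knill-Laflamme condition: errors do not mix logical states, and their
    expectation does not depend on the logical state. *)
Lemma detectingI (J : finType) (d : nat) (phi : F -> {ffun J -> F} -> C) :
  (forall (S : {set J}) (A : J -> F -> F -> C), (#|S| < d)%N ->
    (forall j, j \notin S -> scalar_at A j) ->
    (forall s t, s != t -> sandwich (phi s) (phi t) A = 0) /\
    forall s, sandwich (phi s) (phi s) A = sandwich (phi 0) (phi 0) A) ->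
  detecting d phi.
Proof.
move=> H S A Sd scA; have [H0 H1] := H S A Sd scA.
exists (sandwich (phi 0) (phi 0) A) => s t.
by have [<-|st] := eqVneq s t; [rewrite H1 mulr1 | rewrite H0 ?mulr0].
Qed.

End Sandwich.

(** * Concatenated codes *)

Section Concatenation.
Variables (C : numClosedFieldType) (F : finFieldType) (J K : finType).

Definition slice (x : {ffun J * K -> F}) (j : J) : {ffun K -> F} :=
  [ffun k => x (j, k)].

Definition concat (phi : F -> {ffun J -> F} -> C) (psi : F -> {ffun K -> F} -> C)
    (s : F) (x : {ffun J * K -> F}) : C :=
  \sum_(y : {ffun J -> F}) phi s y * \prod_j psi (y j) (slice x j).

Lemma sum_slice (G : J -> {ffun K -> F} -> C) :
  \sum_(x : {ffun J * K -> F}) \prod_j G j (slice x j) = \prod_j \sum_u G j u.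
Proof.
rewrite bigA_distr_bigA.
rewrite (reindex (fun h : {ffun J -> {ffun K -> F}} =>
  [ffun p : J * K => h p.1 p.2])) /=.
  apply: eq_bigr => h _; apply: eq_bigr => j _; congr (G j _).
  by apply/ffunP => k; rewrite !ffunE.
exists (fun x => [ffun j => slice x j]) => [h|x] _.
  by apply/ffunP => j; apply/ffunP => k; rewrite !ffunE.
by apply/ffunP => -[j k]; rewrite !ffunE.
Qed.

(** For fixed outer words y and y' the summand factors over the blocks, so summing over the inner
    words leaves one inner matrix element per outer position. Product operators thus induce product
    operators on the outer code. *)
Lemma sandwich_concat (phi : F -> {ffun J -> F} -> C)
    (psi : F -> {ffun K -> F} -> C) (A : J * K -> F -> F -> C) (s t : F) :
  sandwich (concat phi psi s) (concat phi psi t) A =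
  sandwich (phi s) (phi t)
    (fun j a b => sandwich (psi a) (psi b) (fun k => A (j, k))).
Proof.
pose T (y y' : {ffun J -> F}) (x x' : {ffun J * K -> F}) :=
  \prod_j ((psi (y j) (slice x j))^* *
    \prod_k A (j, k) (slice x j k) (slice x' j k) * psi (y' j) (slice x' j)).
transitivity (\sum_(x : {ffun J * K -> F}) \sum_(x' : {ffun J * K -> F})
    \sum_(y : {ffun J -> F}) \sum_(y' : {ffun J -> F})
      (phi s y)^* * T y y' x x' * phi t y').
  apply: eq_bigr => x _; apply: eq_bigr => x' _; rewrite /concat rmorph_sum.
  rewrite !mulr_suml; apply: eq_bigr => y _; rewrite mulr_sumr.
  apply: eq_bigr => y' _; rewrite rmorphM rmorph_prod /T !big_split /=.
  rewrite pair_big /=.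
  have -> : \prod_p A (p.1, p.2) (slice x p.1 p.2) (slice x' p.1 p.2) =
            \prod_p A p (x p) (x' p).
    by apply: eq_bigr => -[j k] _; rewrite !ffunE.
  ring.
transitivity (\sum_(y : {ffun J -> F}) \sum_(y' : {ffun J -> F})
    \sum_(x : {ffun J * K -> F}) \sum_(x' : {ffun J * K -> F})
      (phi s y)^* * T y y' x x' * phi t y').
  under eq_bigr do rewrite exchange_big.
  rewrite exchange_big; apply: eq_bigr => y _.
  under eq_bigr do rewrite exchange_big.
  by rewrite exchange_big.
apply: eq_bigr => y _; apply: eq_bigr => y' _.
rewrite /sandwich -(sum_slice (fun j u => \sum_(u' : {ffun K -> F})
  (psi (y j) u)^* * \prod_k A (j, k) (u k) (u' k) * psi (y' j) u')).
rewrite mulr_sumr mulr_suml; apply: eq_bigr => x _.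
rewrite -(sum_slice (fun j u' => (psi (y j) (slice x j))^* *
  \prod_k A (j, k) (slice x j k) (u' k) * psi (y' j) u')).
by rewrite mulr_sumr mulr_suml.
Qed.

(* A block with fewer than e errors acts as a scalar on the logical value of the
   inner code, so that fewer than d blocks act nontrivially on the outer code. *)
Lemma concat_shift_code d e (phi : F -> {ffun J -> F} -> C)
    (psi : F -> {ffun K -> F} -> C) :
  (0 < d)%N -> (0 < e)%N -> shift_code d phi -> shift_code e psi ->
  shift_code (d * e) (concat phi psi).
Proof.
move=> d_gt0 e_gt0 [detphi nzphi [v phiv]] [detpsi nzpsi [w psiw]]; split.
- move=> S A Sde scA; pose blk j := [set k | (j, k) \in S].
  pose T := [set j | (e <= #|blk j|)%N].
  (* Each block in [T] holds at least e errors, so e * #|T| <= #|S| < d * e. *)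
  have Td : (#|T| < d)%N.
    rewrite -(ltn_pmul2r e_gt0); apply: leq_ltn_trans Sde.
    rewrite -sum_nat_const; apply: (@leq_trans (\sum_j #|blk j|)).
      rewrite [leqRHS](bigID (mem T)) /= -[leqLHS]addn0; apply: leq_add => //.
      by apply: leq_sum => j; rewrite inE.
    rewrite (eq_bigr (fun j => \sum_(k | (j, k) \in S) 1%N)) => [|j _]; last first.
      by rewrite -sum1_card; apply: eq_bigl => k; rewrite inE.
    by rewrite pair_big_dep -sum1_card; apply/eq_leq/eq_bigl => -[].
  pose B j a b := sandwich (psi a) (psi b) (fun k => A (j, k)).
  have scB j : j \notin T -> scalar_at B j.
    rewrite inE -ltnNge => /detpsi H; have [|c Bc] := H (fun k => A (j, k)).
      by move=> k; rewrite inE => /scA.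
    by exists c.
  have [c Hc] := detphi T B Td scB.
  by exists c => s t; rewrite sandwich_concat Hc.
- rewrite sandwich_concat.
  (* Detection of the empty error set says that the inner states are orthogonal with a common
     squared norm c. *)
  have [c Hc] : exists c, forall a b, sandwich (psi a) (psi b) (@idop C F K) =
      c * (a == b)%:R.
    apply: (detpsi set0) => [|k _]; first by rewrite cards0.
    by exists 1 => a b; rewrite mul1r.
  rewrite (@sandwich_scale _ _ _ _ _ (@idop C F J) _ (fun _ => c)); last first.
    by move=> j a b; rewrite -Hc.
  rewrite mulf_neq0 // prodf_seq_neq0; apply/allP => j _ /=.
  by move: nzpsi; rewrite Hc eqxx mulr1.
(* The outer shift of symbol j by c * v j is carried out inside block j by adding c * v j times
   [w]. *)
exists (fun p => v p.1 * w p.2) => s c x.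
rewrite /concat (reindex_inj (addIr [ffun j => c * v j])) /=.
apply: eq_bigr => y _; rewrite phiv; congr (_ * _); apply: eq_bigr => j _.
rewrite !ffunE -(psiw (y j) (c * v j)); congr (psi _ _).
by apply/ffunP => k; rewrite !ffunE mulrA.
Qed.

End Concatenation.

(** * The q-ary Shor code *)

Section ShorCode.
Variables (C : numClosedFieldType) (F : finFieldType) (m : nat).
Local Notation I := 'I_m.+1.

(* Shor's code, unnormalized: every row of the array is constant, and the
   logical value is the sum of the common values of the rows. *)
Definition shor (s : F) (x : {ffun I * I -> F}) : C :=
  ([forall i, forall k, x (i, k) == x (i, ord0)] &&
   (\sum_i x (i, ord0) == s))%:R.

Lemma shor_neq0 s (x : {ffun I * I -> F}) : shor s x != 0 ->
  (forall i k, x (i, k) = x (i, ord0)) /\ \sum_i x (i, ord0) = s.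
Proof.
rewrite pnatr_eq0 eqb0 negbK => /andP[/forallP cx /eqP sx]; split=> // i k.
by have /forallP/(_ k)/eqP := cx i.
Qed.

Definition row_indicator (i : I) (p : I * I) : F := (p.1 == i)%:R.

Lemma shor_shift (i : I) s c (x : {ffun I * I -> F}) :
  shor (s + c) (x + [ffun p => c * row_indicator i p]) = shor s x.
Proof.
rewrite /shor; congr (nat_of_bool (_ && _))%:R.
  apply: eq_forallb => j; apply: eq_forallb => k.
  by rewrite !ffunE /row_indicator /= (inj_eq (addIr _)).
under eq_bigr do rewrite !ffunE /row_indicator /=.
rewrite big_split /= [X in _ + X](bigD1 i) //= eqxx mulr1.
rewrite [X in c + X]big1 => [|j /negbTE->]; last by rewrite mulr0.
by rewrite addr0 (inj_eq (addIr _)).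
Qed.

(** Fewer than m + 1 errors leave a clean position in every row, which reveals all row values and
    hence s. They also leave an entire row [i0] clean, and adding -s along it carries the state of s
    to that of 0. *)
Lemma shor_detecting : detecting m.+1 shor.
Proof.
apply: detectingI => S A Sm scA.
have row i : exists k, (i, k) \notin S.
  apply/existsP; rewrite -negb_forall; apply: contraL Sm => /forallP full.
  have inj_i : injective (pair i : I -> I * I) by move=> k k' [].
  rewrite -leqNgt -[leqLHS]card_ord -(card_imset _ inj_i).
  by apply/subset_leq_card/subsetP => p /imsetP[k _ ->].
have [i0 Si0] : exists i, forall k, (i, k) \notin S.
  have /existsP[i iS] : [exists i, i \notin [set p.1 | p in S]].
    rewrite -negb_forall; apply: contraL Sm => /forallP full.
    rewrite -leqNgt -[leqLHS]card_ord; apply: leq_trans (leq_imset_card fst S).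
    by apply/subset_leq_card/subsetP => i _.
  by exists i => k; apply: contra iS => /(imset_f fst).
split=> [s t st|s].
  rewrite (@eq_sandwich _ _ _ S A _ _ (fun => 0) (fun => 0)) // => [|x y xy].
    by apply: big1 => x _; apply: big1 => y _; rewrite mulr0.
  have [->|/shor_neq0[cx sx]] := eqVneq (shor s x) 0; first by rewrite conjC0 !mul0r.
  have [->|/shor_neq0[cy ty]] := eqVneq (shor t y) 0; first by rewrite !mulr0.
  case/eqP: st; rewrite -sx -ty; apply: eq_bigr => i _.
  by have [k ik] := row i; rewrite -(cx i k) -(cy i k) xy.
have w0 p : p \in S -> ([ffun p => - s * row_indicator i0 p] : {ffun I * I -> F}) p = 0.
  case: p => i k iS; rewrite ffunE /row_indicator /=.
  by case: eqVneq iS => [->|_ _]; rewrite ?(negbTE (Si0 k)) ?mulr0.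
rewrite -[RHS](sandwich_shift _ _ scA w0) -(subrr s).
by apply: (@eq_sandwich _ _ _ S) => // x y _; rewrite !shor_shift.
Qed.

Lemma shor_code : shift_code m.+1 shor.
Proof.
split; first exact: shor_detecting; last first.
  by exists (row_indicator ord0); exact: shor_shift.
rewrite sandwich_id psumr_neq0 => [|x _]; last by rewrite mulrC mul_conjC_ge0.
apply/hasP; exists 0; rewrite ?mem_index_enum //= /shor.
rewrite big1 => [|i _]; last by rewrite ffunE.
rewrite eqxx andbT (_ : [forall i, _] = true) ?conjC1 ?mulr1 ?ltr01 //.
by apply/forallP => i; apply/forallP => k; rewrite !ffunE.
Qed.

End ShorCode.

(** * The five-qudit code of the pentagon *)

Section PentagonCode.
Variable F : finFieldType.
Implicit Types (x v p : {ffun 'I_5 -> F}) (S : {set 'I_5}).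

(** The quadratic form of the 5-cycle, the ring in question: addition in ['I_5] is modulo 5. Its
    polar form is given by the adjacency map [ring_adj]. *)
Definition ring_form x : F := \sum_k x k * x (k + 1).

Definition ring_adj v : {ffun 'I_5 -> F} := [ffun k => v (k - 1) + v (k + 1)].

Definition dotp x p : F := \sum_k x k * p k.

Lemma dotpDl x v p : dotp (x + v) p = dotp x p + dotp v p.
Proof. by rewrite -big_split; apply: eq_bigr => k _; rewrite !ffunE mulrDl. Qed.

Lemma dotpDr x v p : dotp p (x + v) = dotp p x + dotp p v.
Proof. by rewrite -big_split; apply: eq_bigr => k _; rewrite !ffunE mulrDr. Qed.

Lemma ring_formD x v :
  ring_form (x + v) = ring_form x + dotp x (ring_adj v) + ring_form v.
Proof.
have -> : dotp x (ring_adj v) =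
    \sum_k x (k + 1) * v k + \sum_k x k * v (k + 1).
  rewrite (reindex_inj (addIr (- 1))) -big_split /=; apply: eq_bigr => k _.
  by rewrite subrK ffunE mulrDr.
rewrite addrA -!big_split /=; apply: eq_bigr => k _; rewrite !ffunE; ring.
Qed.

(** Up to rotation two error positions are 0 and d, with d = 0 for a single one. The entries of the
    witnesses are 0, 1 and -1, and those of the first kind have sum 1 or -1, so they serve in every
    characteristic. *)
Lemma pentagon_vectors (d : 'I_5) :
  (exists v, [/\ v 0 = 0, v d = 0, ring_adj v 0 = 0, ring_adj v d = 0 &
                 \sum_k v k != 0]) /\
  (exists v, [/\ v 0 = 0, v d = 0, ring_adj v 0 = 1 & ring_adj v d = 1]).
Proof.
pose vec s : {ffun 'I_5 -> F} := [ffun k : 'I_5 => nth 0 s k].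
have sumv a b c e f : \sum_k vec [:: a; b; c; e; f] k = a + b + c + e + f.
  by rewrite !big_ord_recl big_ord0 !ffunE /=; ring.
have add1 : (1 : F) + -1 = 0 by exact: subrr.
have add1' : (-1 : F) + 1 = 0 by exact: addNr.
have nz1 : (1 : F) != 0 by exact: oner_neq0.
have nzN1 : (-1 : F) != 0 by rewrite oppr_eq0.
case: d => [[|[|[|[|[|//]]]]] ltd]; split.
- exists (vec [:: 0; 0; 0; 1; 0]).
  by split; rewrite ?sumv ?add0r ?addr0 // !ffunE //; exact: addr0.
- exists (vec [:: 0; 0; 1; 0; 1]); split; rewrite !ffunE //; exact: addr0.
- exists (vec [:: 0; 0; 0; 1; 0]).
  by split; rewrite ?sumv ?add0r ?addr0 // !ffunE //; exact: addr0.
- exists (vec [:: 0; 0; 1; 0; 1]); split; rewrite !ffunE //.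
    exact: addr0.
  exact: add0r.
- exists (vec [:: 0; 1; 0; -1; -1]).
  by split; rewrite ?sumv ?add0r ?addr0 ?add1 ?add0r // !ffunE.
- exists (vec [:: 0; 1; 0; 0; 0]); split; rewrite !ffunE //.
    exact: add0r.
  exact: addr0.
- exists (vec [:: 0; -1; -1; 0; 1]).
  by split; rewrite ?sumv ?add0r ?addr0 -?addrA ?add1' ?addr0 // !ffunE.
- exists (vec [:: 0; 0; 0; 0; 1]); split; rewrite !ffunE //.
    exact: addr0.
  exact: add0r.
- exists (vec [:: 0; 0; 1; 0; 0]).
  by split; rewrite ?sumv ?add0r ?addr0 // !ffunE //; exact: addr0.
- exists (vec [:: 0; 1; 0; 1; 0]); split; rewrite !ffunE //.
    exact: add0r.
  exact: addr0.
Qed.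

Lemma pentagon_pair S : (#|S| < 3)%N ->
  exists i d : 'I_5, forall k, k \in S -> k = i \/ k = i + d.
Proof.
rewrite ltnS leq_eqVlt ltnS leq_eqVlt ltnS leqn0.
move=> /or3P[/cards2P[i [j [_ ->]]]|/cards1P[i ->]|/eqP/cards0_eq->].
- exists i, (j - i) => k; rewrite !inE (addrC i) subrK.
  by move=> /orP[] /eqP->; [left|right].
- by exists i, 0 => k; rewrite inE => /eqP->; left.
by exists 0, 0 => k; rewrite inE.
Qed.

(* S is the set of positions in error.  The first v gives, through
   [ring_stateD], an operator supported off S that multiplies the code state of s
   by a nontrivial character of s; the second one gives a logical shift
   supported off S. *)
Lemma pentagon_cleaning S : (#|S| < 3)%N ->
  (exists v, (forall k, k \in S -> v k = 0 /\ ring_adj v k = 0) /\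
             \sum_k v k != 0) /\
  (exists v, forall k, k \in S -> v k = 0 /\ ring_adj v k = 1).
Proof.
move=> /pentagon_pair[i [d Sid]].
(* Rotation by i carries the positions 0 and d to i and i + d. *)
pose rot v : {ffun 'I_5 -> F} := [ffun k => v (k - i)].
have rotE v k : ring_adj (rot v) k = ring_adj v (k - i).
  by rewrite !ffunE !(addrAC _ _ (- i)).
have rot0 v a b : v 0 = a -> v d = a -> ring_adj v 0 = b -> ring_adj v d = b ->
    forall k, k \in S -> rot v k = a /\ ring_adj (rot v) k = b.
  by move=> v0 vd w0 wd k /Sid[] ->; rewrite rotE ffunE ?subrr // addrC addKr.
have [[v [v0 vd w0 wd sv]] [u [u0 ud x0 xd]]] := pentagon_vectors d.
split; last by exists (rot u); exact: rot0.
exists (rot v); split; first exact: rot0.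
rewrite (reindex_inj (addIr i)) /=.
by under eq_bigr do rewrite ffunE addrK.
Qed.

Variables (C : numClosedFieldType) (chi : F -> C).
Hypothesis chiD : forall a b, chi (a + b) = chi a * chi b.
Hypothesis chiJ : forall a, (chi a)^* * chi a = 1.
Hypothesis chi_nontrivial : exists a, chi a != 1.

Lemma character0 : chi 0 = 1.
Proof.
have nz : chi 0 != 0.
  by apply: contra_eq_neq (chiJ 0) => ->; rewrite mulr0 eq_sym oner_eq0.
by apply: (mulfI nz); rewrite -chiD addr0 mulr1.
Qed.

Lemma character_conj a : (chi a)^* = chi (- a).
Proof.
have nz : chi a != 0.
  by apply: contra_eq_neq (chiJ a) => ->; rewrite mulr0 eq_sym oner_eq0.
by apply: (mulIf nz); rewrite chiJ -chiD addNr character0.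
Qed.

(* The graph state of the 5-cycle in the Fourier basis: in this basis the
   logical shift of the code below is an X-type error. *)
Definition ring_state p : C := \sum_x chi (ring_form x + dotp x p).

(** The substitution of x + v for x in the sum. These are the stabilizer relations of the graph
    state: a shift by [ring_adj v] amounts to a phase whose exponent is affine in p. *)
Lemma ring_stateD p v :
  ring_state (p + ring_adj v) = chi (- (ring_form v + dotp v p)) * ring_state p.
Proof.
rewrite /ring_state [in RHS](reindex_inj (addIr v)) mulr_sumr /=.
apply: eq_bigr => x _; rewrite -chiD ring_formD dotpDl dotpDr; congr chi; ring.
Qed.

(** Summed over all p, the terms with x != 0 cancel by orthogonality of characters, and x = 0
    contributes the number of words p, which is nonzero. *)
Lemma ring_state_neq0 : exists p, ring_state p != 0.
Proof.
apply/existsP; rewrite -negb_forall; apply/negP => /forallP all0.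
have /eqP : \sum_p ring_state p = 0 by apply: big1 => p _; apply/eqP/all0.
rewrite exchange_big (bigD1 (0 : {ffun _ -> F})) //= [X in _ + X]big1 => [|x x0].
  rewrite addr0 (eq_bigr (fun=> 1)) => [|p _].
    by rewrite sumr_const pnatr_eq0 => /eqP/card0_eq/(_ (0 : {ffun _ -> F})).
  rewrite /ring_form /dotp !big1 ?addr0 ?character0 // => k _; rewrite !ffunE mul0r //.
have [k xk] : exists k, x k != 0.
  apply/existsP; rewrite -negb_forall; apply: contra x0 => /forallP x0.
  by apply/eqP/ffunP => k; rewrite ffunE; apply/eqP.
have [a chia] := chi_nontrivial.
(* Shifting p by [r] adds a to [dotp x p], which multiplies the sum over p by chi a != 1. *)
pose r : {ffun 'I_5 -> F} := [ffun j => (j == k)%:R * (a / x k)].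
have xr : dotp x r = a.
  rewrite /dotp (bigD1 k) //= big1 => [|j /negbTE jk]; rewrite ffunE.
    by rewrite eqxx mul1r addr0 mulrCA divff // mulr1.
  by rewrite jk mul0r mulr0.
set s := \sum_p _; have : s = chi a * s.
  rewrite {1}/s (reindex_inj (addIr r)) mulr_sumr; apply: eq_bigr => p _.
  by rewrite -chiD dotpDr xr addrA addrC.
move/eqP; rewrite -subr_eq0 -{1}[s]mul1r -mulrBl mulf_eq0 subr_eq0 eq_sym.
by rewrite (negbTE chia) => /eqP.
Qed.

(** Before the Fourier transform, the logical value s multiplies the amplitude of the graph state at
    x by chi (s * \sum_k x k): this is the usual graph code. *)
Definition pentagon (s : F) p : C := ring_state (p + [ffun => s]).

Lemma dotp_const v s : dotp v [ffun => s] = (\sum_k v k) * s.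
Proof. by rewrite mulr_suml; apply: eq_bigr => k _; rewrite ffunE. Qed.

Lemma dotp_off S v x (y : {ffun _ -> F}) : (forall k, k \in S -> v k = 0) ->
  (forall k, k \notin S -> x k = y k) -> dotp v x = dotp v y.
Proof.
move=> v0 xy; apply: eq_bigr => k _.
by have [/v0->|/xy->] := boolP (k \in S); rewrite ?mul0r.
Qed.

(** For s != t, a stabilizer shift supported off [S] fixes the matrix element and also multiplies it
    by chi a != 1, so it vanishes. For s = t, a shift supported off [S] turns state s into state 0
    up to phases, which cancel between bra and ket. *)
Lemma pentagon_detecting : detecting 3 pentagon.
Proof.
apply: detectingI => S A S3 scA.
have [[v [v0 sv]] [u u1]] := pentagon_cleaning S3.
split=> [s t st|s].
  have [a chia] := chi_nontrivial.
  (* [l] is scaled so that the phases for s and t differ by exactly chi a. *)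
  pose l := a / ((s - t) * \sum_k v k); pose lv : {ffun 'I_5 -> F} := [ffun k => l * v k].
  have lv0 k : k \in S -> lv k = 0 by move=> /v0[vk _]; rewrite ffunE vk mulr0.
  have la : (\sum_k lv k) * (s - t) = a.
    under eq_bigr do rewrite ffunE.
    by rewrite -mulr_sumr -mulrA (mulrC (\sum_k _)) divfK // mulf_neq0 ?subr_eq0.
  have glv k : k \in S -> ring_adj lv k = 0.
    by move=> /v0[_]; rewrite !ffunE -mulrDr => ->; rewrite mulr0.
  have K : sandwich (pentagon s) (pentagon t) A =
           chi a * sandwich (pentagon s) (pentagon t) A.
    rewrite -{1}(sandwich_shift _ _ scA glv) -sandwichZl.
    apply: eq_sandwich scA _ => x y xy; rewrite /pentagon !(addrAC _ (ring_adj lv)).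
    rewrite !ring_stateD !dotpDr !dotp_const (dotp_off lv0 xy) rmorphM /= character_conj.
    rewrite -la mulrACA -chiD [RHS]mulrCA; congr (chi _ * _); ring.
  apply/eqP; move/eqP: K; rewrite -subr_eq0 -{1}[sandwich _ _ _]mul1r -mulrBl.
  by rewrite mulf_eq0 subr_eq0 eq_sym (negbTE chia).
pose su : {ffun 'I_5 -> F} := [ffun k => s * u k].
have su0 k : k \in S -> su k = 0 by move=> /u1[uk _]; rewrite ffunE uk mulr0.
(* On [S] the neighbour sums of [su] equal s, so the constant word s is [ring_adj su] plus a word
   vanishing on [S]. *)
pose r := [ffun => s] - ring_adj su.
have r0 k : k \in S -> r k = 0.
  by move=> /u1[_]; rewrite !ffunE -mulrDr => ->; rewrite mulr1 subrr.
rewrite -[RHS](sandwich_shift _ _ scA r0); apply: eq_sandwich scA _ => x y xy.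
have psiE p : pentagon s p =
    chi (- (ring_form su + dotp su (p + r))) * pentagon 0 (p + r).
  rewrite /pentagon (_ : _ + [ffun => 0] = p + r); last first.
    by apply/ffunP => k; rewrite !ffunE addr0.
  by rewrite -ring_stateD /r addrA subrK.
rewrite !psiE !dotpDr (dotp_off su0 xy) rmorphM /= character_conj mulrACA -chiD opprK.
by rewrite subrr character0 mul1r.
Qed.

Lemma pentagon_code : shift_code 3 pentagon.
Proof.
split; first exact: pentagon_detecting; last first.
  exists (fun=> -1) => s c x; congr ring_state; apply/ffunP => k.
  by rewrite !ffunE; ring.
have [p rp] := ring_state_neq0.
rewrite sandwich_id psumr_neq0 => [|x _]; last by rewrite mulrC mul_conjC_ge0.
apply/hasP; exists p; rewrite ?mem_index_enum //= /pentagon.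
rewrite (_ : p + _ = p); first by rewrite mulrC mul_conjC_gt0.
by apply/ffunP => k; rewrite !ffunE addr0.
Qed.

End PentagonCode.

(** * Arithmetic of the length and the distance *)

(** The largest m with 5m^2 <= N has N <= 5m^2 + 10m + 4, which is at most 9m^2 - 3m once m >= 4,
    that is N >= 80. For N = 26, m = 2 gives 20 <= 26 <= 30. *)
Lemma five_square_interval (N : nat) : (N = 26 \/ 80 <= N)%N ->
  exists2 m, (0 < m)%N & (5 * (m * m) <= N <= 3 * m * (3 * m - 1))%N.
Proof.
case=> [->|N80]; first by exists 2.
have [M MN maxM] : exists2 M, (5 * (M * M) <= N)%N &
    forall k, (5 * (k * k) <= N)%N -> (k <= M)%N.
  have ex : exists k, (5 * (k * k) <= N)%N by exists 0%N.
  have bd k : (5 * (k * k) <= N)%N -> (k <= N)%N by nia.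
  by case: (ex_maxnP ex bd) => M MN maxM; exists M.
have M4 : (4 <= M)%N by apply: maxM; lia.
exists M; first by lia.
rewrite MN /=; have : ~~ (5 * (M.+1 * M.+1) <= N)%N.
  by apply/negP => /maxM; rewrite ltnn.
nia.
Qed.

(** If p >= 5 then n >= 125; if p = 3 then n = 27k with k odd, so k = 1 or k >= 3. *)
Lemma odd_multiple_of_cube (n p : nat) : odd n -> prime p -> (p ^ 3 %| n)%N ->
  n = 27 \/ (81 <= n)%N.
Proof.
move=> oddn pr_p /dvdnP[k nE].
have oddp : odd p by move: oddn; rewrite nE oddM oddX /= => /andP[].
have oddk : odd k by move: oddn; rewrite nE oddM => /andP[].
have [p3|p3] := eqVneq p 3.
  by move: nE oddk; rewrite p3; case: k => [|[|[|k]]] // -> _; [left|right]; lia.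
have p5 : (5 <= p)%N.
  by move: (prime_gt1 pr_p) oddp p3; case: p pr_p nE => [|[|[|[|[|p]]]]].
have k1 : (0 < k)%N by case: k oddk nE.
right; rewrite nE; have : (5 ^ 3 <= p ^ 3)%N by rewrite leq_exp2r.
by nia.
Qed.

(** By definition of the order, p divides q^(2t) - 1. With 2z < [logn p n] this makes p^3 divide
    n. *)
Lemma exactly_divides_gt0 (p q t z : nat) : (0 < q)%N ->
  is_mult_order p (q ^ 2) t -> exactly_divides p z (q ^ (2 * t) - 1) -> (0 < z)%N.
Proof.
move=> q0 [t0 qt _] [_]; rewrite lt0n; apply: contra => /eqP->.
by rewrite expn1 -eqn_mod_dvd ?expn_gt0 ?q0 // expnM; apply/eqP.
Qed.

Lemma min_over_primes_le (n p : nat) (f : nat -> nat) :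
  p \in primes n -> (min_over_primes n f <= f p)%N.
Proof.
rewrite /min_over_primes; elim: (primes n) => //= r s IH.
rewrite inE big_cons => /predU1P[->|/IH ps]; first exact: geq_minl.
exact: leq_trans (geq_minr _ _) ps.
Qed.

(** * The projector on the span of orthogonal vectors of equal norm *)

Section CodeProjector.
Variables (R : realType) (F I : finType).
Implicit Types (u v w : qspace R I).

Lemma qdotDr u v w : qdot u (v + w) = qdot u v + qdot u w.
Proof. by rewrite -big_split; apply: eq_bigr => x _; rewrite ffunE mulrDr. Qed.

Lemma qdotZr (a : Cplx R) u v : qdot u (a *: v) = a * qdot u v.
Proof. by rewrite mulr_sumr; apply: eq_bigr => x _; rewrite ffunE mulrCA. Qed.

Lemma qdot0r u : qdot u 0 = 0.
Proof. by apply: big1 => x _; rewrite ffunE mulr0. Qed.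

Lemma qdotBr u v w : qdot u (v - w) = qdot u v - qdot u w.
Proof. by rewrite -scaleN1r qdotDr qdotZr mulN1r. Qed.

Lemma qdot_sumr (K : finType) u (v : K -> qspace R I) :
  qdot u (\sum_k v k) = \sum_k qdot u (v k).
Proof. by apply: (big_morph _ (qdotDr u) (qdot0r u)). Qed.

Lemma qdot_suml (K : finType) (a : K -> Cplx R) (v : K -> qspace R I) w :
  qdot (\sum_k a k *: v k) w = \sum_k (a k)^* * qdot (v k) w.
Proof.
rewrite /qdot; under [RHS]eq_bigr do rewrite mulr_sumr.
rewrite exchange_big; apply: eq_bigr => x _.
rewrite sum_ffunE rmorph_sum mulr_suml; apply: eq_bigr => k _.
by rewrite ffunE rmorphM mulrA.
Qed.

Lemma ket_sum u : u = \sum_x (u x : Cplx R) *: ket R x.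
Proof.
apply/ffunP => y; rewrite sum_ffunE (bigD1 y) //= big1 => [|x xy].
  by rewrite !ffunE eqxx addr0; exact/esym/mulr1.
by rewrite !ffunE eq_sym (negbTE xy); exact: mulr0.
Qed.

Lemma op_on_basis_sum (phi : I -> qspace R I) u :
  op_on_basis phi u = \sum_x (u x : Cplx R) *: phi x.
Proof.
rewrite {1}(ket_sum u) linear_sum; apply: eq_bigr => x _.
by rewrite linearZ /= op_on_basisE.
Qed.

Variables (psi : F -> qspace R I) (c0 : Cplx R).
Hypothesis c0_neq0 : c0 != 0.
Hypothesis qdot_psi : forall s t, qdot (psi s) (psi t) = c0 * (s == t)%:R.

Definition code_space : {vspace qspace R I} := <<[seq psi s | s <- enum F]>>%VS.

(** The factor [c0^-1] compensates for the vectors [psi s] being unnormalized, with squared norm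
    [c0]. *)
Definition code_proj : 'End(qspace R I) :=
  linfun (fun u => \sum_s (c0^-1 * qdot (psi s) u) *: psi s).

Lemma code_projE u : code_proj u = \sum_s (c0^-1 * qdot (psi s) u) *: psi s.
Proof.
pose g u := \sum_s (c0^-1 * qdot (psi s) u) *: psi s.
have ling : linear g.
  move=> a v w; rewrite /g scaler_sumr -big_split; apply: eq_bigr => s _ /=.
  by rewrite qdotDr qdotZr scalerA -scalerDl mulrDr mulrCA.
pose lg := GRing.isLinear.Build (Cplx R) _ _ _ g ling.
pose h : {linear qspace R I -> qspace R I} := HB.pack g lg.
by rewrite /code_proj (_ : (fun u => _) = h) // lfunE.
Qed.

Lemma psi_code s : psi s \in code_space.
Proof. by apply: memv_span; apply: map_f; rewrite mem_enum. Qed.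

Lemma qdot_code_proj s u : qdot (psi s) (code_proj u) = qdot (psi s) u.
Proof.
rewrite code_projE qdot_sumr (bigD1 s) //= big1 => [|t ts].
  by rewrite qdotZr qdot_psi eqxx mulr1 addr0 mulrAC mulVf ?mul1r.
by rewrite qdotZr qdot_psi eq_sym (negbTE ts) !mulr0.
Qed.

Lemma code_proj_psi s : code_proj (psi s) = psi s.
Proof.
rewrite code_projE (bigD1 s) //= big1 => [|t ts].
  by rewrite qdot_psi eqxx mulr1 mulVf // scale1r addr0.
by rewrite qdot_psi (negbTE ts) !mulr0 scale0r.
Qed.

Lemma code_space_sum v : v \in code_space -> exists a, v = \sum_s a s *: psi s.
Proof.
pose X := in_tuple [seq psi s | s <- enum F].
move=> vX; rewrite (coord_span (X := X) vX).
have sX : size [seq psi s | s <- enum F] = #|F| by rewrite size_map -cardE.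
exists (fun s => coord X (cast_ord (esym sX) (enum_rank s)) v).
rewrite (reindex (cast_ord (esym sX))) /=; last first.
  by apply: onW_bij; exact: (Bijective (cast_ordK _) (cast_ordKV _)).
rewrite (reindex (@enum_rank F)) /=; last exact/onW_bij/enum_rank_bij.
apply: eq_bigr => s _; congr (_ *: _).
by rewrite (nth_map s) ?nth_enum_rank // -cardE; exact: ltn_ord.
Qed.

Lemma code_proj_orthogonal : is_orthogonal_projector code_space code_proj.
Proof.
move=> u; split.
  by rewrite code_projE memv_suml // => s _; rewrite memvZ ?psi_code.
move=> v /code_space_sum[a ->]; rewrite qdot_suml big1 // => s _.
by rewrite qdotBr qdot_code_proj subrr mulr0.
Qed.

Lemma dim_code_space : \dim code_space = #|F|.
Proof.
have : free [seq psi s | s <- enum F].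
  apply/(freeP (X := in_tuple _)) => k k0 i.
  have sX : size [seq psi s | s <- enum F] = #|F| by rewrite size_map -cardE.
  pose j := enum_val (cast_ord sX i).
  have nthX (l : 'I_(size [seq psi s | s <- enum F])) :
      [seq psi s | s <- enum F]`_l = psi (enum_val (cast_ord sX l)).
    by rewrite (nth_map j) -?cardE -?sX // (enum_val_nth j).
  have := qdot0r (psi j); rewrite -k0 qdot_sumr (bigD1 i) //= big1 => [|l li].
    rewrite nthX addr0 qdotZr qdot_psi eqxx mulr1.
    by move/eqP; rewrite mulf_eq0 (negbTE c0_neq0) orbF => /eqP.
  rewrite nthX qdotZr qdot_psi (inj_eq enum_val_inj) (inj_eq (@cast_ord_inj _ _ sX)).
  by rewrite eq_sym (negbTE li) !mulr0.
by rewrite /code_space => /eqP->; rewrite size_map -cardE.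
Qed.

(** The sufficient direction of the Knill-Laflamme criterion. *)
Lemma code_proj_detect (E : 'End(qspace R I)) (c : Cplx R) :
  (forall s t, qdot (psi s) (E (psi t)) = c * (s == t)%:R) ->
  (code_proj \o E \o code_proj)%VF = (c0^-1 * c) *: code_proj.
Proof.
move=> Ec; apply/lfunP => u; rewrite !comp_lfunE scale_lfunE /=.
rewrite [LHS]code_projE [in RHS]code_projE scaler_sumr; apply: eq_bigr => s _.
rewrite scalerA; congr (_ *: _).
rewrite code_projE linear_sum qdot_sumr (bigD1 s) //= big1 => [|t ts].
  by rewrite linearZ qdotZr Ec eqxx mulr1 addr0; ring.
by rewrite linearZ qdotZr Ec eq_sym (negbTE ts) !mulr0.
Qed.

(** Used in the converse direction: a matrix element of E on code states refutes detection or
    purity. *)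
Lemma qdot_code_proj_conj (E : 'End(qspace R I)) s t :
  qdot (psi s) ((code_proj \o E \o code_proj)%VF (psi t)) =
  qdot (psi s) (E (psi t)).
Proof. by rewrite !comp_lfunE qdot_code_proj code_proj_psi. Qed.

End CodeProjector.

(** * Padding with ancillas in the state |0> *)

Section AncillaPadding.
Variables (R : realType) (F : finFieldType) (n : nat) (J : finType).
Variable f : J -> 'I_n.
Hypothesis f_inj : injective f.
Local Notation C := (Cplx R).

Definition restrict (x : 'rV[F]_n) : {ffun J -> F} := [ffun j => x 0 (f j)].

Definition extend (u : {ffun J -> F}) : 'rV[F]_n :=
  \row_i (if [pick j | f j == i] is Some j then u j else 0).

Definition ancillas_zero (x : 'rV[F]_n) : bool :=
  [forall i, (i \in codom f) || (x 0 i == 0)].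

Definition pad (phi : {ffun J -> F} -> C) : qspace R 'rV[F]_n :=
  [ffun x : 'rV[F]_n => phi (restrict x) * (ancillas_zero x)%:R].

Lemma extend_f u j : extend u 0 (f j) = u j.
Proof.
rewrite mxE; case: pickP => [k /eqP/f_inj->//|/(_ j)]; by rewrite eqxx.
Qed.

Lemma extend_ancilla u i : i \notin codom f -> extend u 0 i = 0.
Proof.
rewrite mxE; case: pickP => [k /eqP<-|//]; by rewrite codom_f.
Qed.

Lemma extendK : cancel extend restrict.
Proof. by move=> u; apply/ffunP => j; rewrite ffunE extend_f. Qed.

Lemma ancillas_zero_extend u : ancillas_zero (extend u).
Proof.
apply/forallP => i; have [//|/extend_ancilla->] := boolP (i \in codom f).
by rewrite eqxx.
Qed.

Lemma restrictK x : ancillas_zero x -> extend (restrict x) = x.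
Proof.
move=> /forallP x0; apply/rowP => i; have := x0 i.
have [/codomP[j ->] _|ni /eqP->] := boolP (i \in codom f).
  by rewrite extend_f ffunE.
by rewrite extend_ancilla.
Qed.

Lemma sum_ancillas_zero (g : 'rV[F]_n -> C) :
  \sum_(x | ancillas_zero x) g x = \sum_u g (extend u).
Proof.
rewrite (reindex_onto extend restrict) => [|x]; last exact: restrictK.
by apply: eq_bigl => u; rewrite ancillas_zero_extend extendK eqxx.
Qed.

(** The entry of X(a)Z(b) in row x and column y. *)
Definition error_entry (a b x y : F) : C :=
  omega R F ^+ ftrace (b * y) * (x == y + a)%:R.

Lemma Eop_ket (a b y x : 'rV[F]_n) :
  (Eop R a b (ket R y) x : C) =
  \prod_i error_entry (a 0 i) (b 0 i) (x 0 i) (y 0 i).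
Proof.
rewrite /Eop /tensor_op op_on_basisE ffunE; apply: eq_bigr => i _.
have Zk : Zop R (b 0 i) (ket R (y 0 i)) =
    (omega R F ^+ ftrace (b 0 i * y 0 i) : Cplx R) *: ket R (y 0 i).
  exact: op_on_basisE.
have Xk : Xop R (a 0 i) (ket R (y 0 i)) = ket R (y 0 i + a 0 i).
  exact: op_on_basisE.
by rewrite comp_lfunE [X in Xop _ _ X]Zk linearZ /= Xk !ffunE.
Qed.

Lemma qdot_pad (phi phi' : {ffun J -> F} -> C) :
  qdot (pad phi) (pad phi') = \sum_u (phi u)^* * phi' u.
Proof.
transitivity (\sum_(x | ancillas_zero x) (phi (restrict x))^* * phi' (restrict x)).
  rewrite [RHS]big_mkcond; apply: eq_bigr => x _; rewrite !ffunE.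
  by case: ifP => _; rewrite ?mulr1 // !mulr0.
by rewrite sum_ancillas_zero; apply: eq_bigr => u _; rewrite extendK.
Qed.

(** Both words vanish at the ancillas, so each ancilla contributes only its entry at (0, 0), a
    scalar. *)
Lemma qdot_Eop_pad (phi phi' : {ffun J -> F} -> C) (a b : 'rV[F]_n) :
  qdot (pad phi) (Eop R a b (pad phi')) =
  (\prod_(i | i \notin codom f) error_entry (a 0 i) (b 0 i) 0 0) *
  sandwich phi phi' (fun j => error_entry (a 0 (f j)) (b 0 (f j))).
Proof.
pose M (x y : 'rV[F]_n) := \prod_i error_entry (a 0 i) (b 0 i) (x 0 i) (y 0 i).
have EM x : (Eop R a b (pad phi') x : C) = \sum_y (pad phi' y : C) * M x y.
  rewrite {1}/Eop /tensor_op op_on_basis_sum sum_ffunE; apply: eq_bigr => y _.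
  by rewrite /M -(Eop_ket a b y x) /Eop /tensor_op op_on_basisE [LHS]ffunE.
transitivity (\sum_(x | ancillas_zero x) (phi (restrict x))^* *
    \sum_(y | ancillas_zero y) phi' (restrict y) * M x y).
  rewrite [RHS]big_mkcond; apply: eq_bigr => x _; rewrite EM !ffunE.
  case: ifP => _; last by rewrite mulr0 conjC0 mul0r.
  rewrite mulr1 [X in _ = _ * X]big_mkcond; congr (_ * _); apply: eq_bigr => y _.
  by rewrite ffunE; case: ifP => _; rewrite ?mulr1 // mulr0 mul0r.
rewrite sum_ancillas_zero mulr_sumr; apply: eq_bigr => u _.
rewrite sum_ancillas_zero !mulr_sumr; apply: eq_bigr => v _.
rewrite !extendK /M (bigID (mem (codom f))) /=.
rewrite (eq_bigr (fun i => error_entry (a 0 i) (b 0 i) 0 0)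
  (P := fun i => i \notin codom f)) => [|i ni]; last by rewrite !extend_ancilla.
have -> : \prod_(i in codom f) error_entry (a 0 i) (b 0 i) (extend u 0 i) (extend v 0 i)
   = \prod_j error_entry (a 0 (f j)) (b 0 (f j)) (u j) (v j).
  rewrite (eq_bigl [in f @: J]) => [|i]; last first.
    by apply/codomP/imsetP => [[j ->]|[j _ ->]]; exists j.
  by rewrite big_imset => [|j k _ _ /f_inj //]; apply: eq_bigr => j _; rewrite !extend_f.
ring.
Qed.

End AncillaPadding.

(** * From a padded shift code to a degenerate quantum code *)

Lemma omega_neq0 (R : realType) (F : finFieldType) : omega R F != 0.
Proof.
rewrite /omega eq_complex /=; set t := (_ / _); apply/negP => /andP[/eqP c0 /eqP s0].
by have /eqP := cos2Dsin2 t; rewrite c0 s0 expr0n /= addr0 eq_sym oner_eq0.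
Qed.

Lemma error_entry00 (R : realType) (F : finFieldType) (x y : F) :
  error_entry R 0 0 x y = omega R F ^+ ftrace (0 : F) * (x == y)%:R.
Proof. by rewrite /error_entry mul0r addr0. Qed.

Lemma sandwich_logical_shift (C : numClosedFieldType) (F : finFieldType)
    (J : finType) (phi : F -> {ffun J -> F} -> C) (w : J -> F) :
  (forall s c x, phi (s + c) (x + [ffun j => c * w j]) = phi s x) ->
  sandwich (phi 1) (phi 0) (fun j x y => (x == y + w j)%:R) =
  sandwich (phi 0) (phi 0) (@idop C F J).
Proof.
move=> phiw; rewrite /sandwich (reindex_inj (addIr [ffun j => 1 * w j])) /=.
apply: eq_bigr => x _; apply: eq_bigr => y _; rewrite -{1}[1]add0r phiw.
congr (_ * _ * _); apply: eq_bigr => j _.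
by rewrite !ffunE mul1r (inj_eq (addIr _)).
Qed.

(** The distance D is the largest detected value: it is at least d by the detection property and at
    most n because of the logical shift. Since D > 1, a Z error on one ancilla violates purity. *)
Lemma degenerate_quantum_code (R : realType) (F : finFieldType) (n d : nat)
    (J : finType) (phi : F -> {ffun J -> F} -> Cplx R) :
  (1 < d)%N -> (#|J| < n)%N -> shift_code d phi ->
  exists (Q : {vspace qspace R 'rV[F]_n}) (P : 'End(qspace R 'rV[F]_n)) (D : nat),
    [/\ is_quantum_code 1 D Q P, degenerate P D & (d <= D)%N].
Proof.
move=> d_gt1 Jn [det nz [w phiw]].
(* The code occupies the first #|J| positions, and [i0], the next one, is an ancilla. *)
pose f j := widen_ord (ltnW Jn) (enum_rank j); pose i0 := Ordinal Jn.
have f_inj : injective f.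
  by move=> j k /(congr1 val) /= jk; apply/enum_rank_inj/val_inj.
have i0f : i0 \notin codom f.
  apply/codomP => -[j /(congr1 val) /= jE].
  by have := ltn_ord (enum_rank j); rewrite -jE ltnn.
have w_neq0 : omega R F ^+ ftrace (0 : F) != 0 by rewrite expf_neq0 ?omega_neq0.
(* The trace of 0 is kept symbolic: [w0] is a nonzero scalar attached to every position without
   error. *)
set w0 := omega R F ^+ ftrace (0 : F) in w_neq0.
have [c0 Hc0] : exists c, forall s t,
    sandwich (phi s) (phi t) (@idop (Cplx R) F J) = c * (s == t)%:R.
  apply: (det set0) => [|j _]; first by rewrite cards0 (ltn_trans _ d_gt1).
  by exists 1 => a b; rewrite mul1r.
have c0_neq0 : c0 != 0 by move: nz; rewrite Hc0 eqxx mulr1.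
pose psi s := pad f (phi s).
have qdot_psi s t : qdot (psi s) (psi t) = c0 * (s == t)%:R.
  by rewrite qdot_pad // -sandwich_id Hc0.
pose P := code_proj psi c0.
have PEP E s t : qdot (psi s) ((P \o E \o P)%VF (psi t)) = qdot (psi s) (E (psi t)).
  exact: qdot_code_proj_conj.
have detP : detects P d.
  move=> a b ab; set S := [set j | (a 0 (f j), b 0 (f j)) != (0, 0)].
  have Sd : (#|S| < d)%N.
    apply: leq_ltn_trans ab; rewrite -(card_imset _ f_inj).
    by apply/subset_leq_card/subsetP => i /imsetP[j]; rewrite !inE => jS ->.
  have [|c Hc] := det S (fun j => error_entry R (a 0 (f j)) (b 0 (f j))) Sd.
    move=> j; rewrite inE negbK => /eqP[aj bj]; exists w0 => x y.
    by rewrite aj bj error_entry00.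
  eexists; apply: code_proj_detect => s t.
  by rewrite qdot_Eop_pad // Hc mulrA.
have bound D : detects P D -> (D <= n)%N.
  move=> detD; rewrite leqNgt; apply/negP => nD.
  (* The logical shift has weight at most n < D. Its detection would make its matrix element between
     [psi 1] and [psi 0] vanish, whereas this is a nonzero multiple of the squared norm of
     [phi 0]. *)
  have [|c Ec] := detD (extend f [ffun j => w j]) 0.
    by apply: leq_ltn_trans nD; rewrite -[leqRHS]card_ord max_card.
  have := PEP (Eop R (extend f [ffun j => w j]) 0) 1 0; rewrite Ec scale_lfunE.
  rewrite qdotZr /P code_proj_psi // qdot_psi oner_eq0 !mulr0 qdot_Eop_pad //.
  rewrite (@sandwich_scale _ _ _ _ _ (fun j x y => (x == y + w j)%:R) _ (fun=> w0)).
    rewrite sandwich_logical_shift // => /esym/eqP; apply/negP.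
    rewrite !mulf_neq0 // prodf_seq_neq0; apply/allP => i _ //=.
    apply/implyP => ni; rewrite extend_ancilla // mxE error_entry00 eqxx mulr1 //.
  by move=> j x y; rewrite extend_f // ffunE mxE /error_entry mul0r.
have ex : exists D, boolp.asbool (detects P D) by exists d; apply/boolp.asboolP.
have bd D : boolp.asbool (detects P D) -> (D <= n)%N by move=> /boolp.asboolP/bound.
have [D /boolp.asboolP detD maxD] := ex_maxnP ex bd.
have dD : (d <= D)%N by apply/maxD/boolp.asboolP.
exists (code_space psi), P, D; split=> //.
  split=> //; first by rewrite expn1 (dim_code_space c0_neq0 qdot_psi).
    exact: code_proj_orthogonal.
  by move=> D' /boolp.asboolP/maxD.
(* Z(1) on the ancilla [i0] has weight one, and its expectation in [psi 0] is nonzero. *)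
move=> pureD; pose b : 'rV[F]_n := delta_mx 0 i0.
have /(pureD 0 b) E0 : (0 < weight 0 b < D)%N.
  rewrite /weight (_ : [set i | _] = [set i0]) ?cards1 ?(leq_trans d_gt1) //.
  apply/setP => i; rewrite !inE !mxE xpair_eqE eqxx /=.
  by case: (i == i0); rewrite ?oner_eq0 ?eqxx.
have := PEP (Eop R 0 b) 0 0; rewrite E0 lfunE qdot0r qdot_Eop_pad //.
rewrite (@sandwich_scale _ _ _ _ _ (@idop (Cplx R) F J) _ (fun=> w0)).
  move=> /esym/eqP; apply/negP.
  rewrite !mulf_neq0 // prodf_seq_neq0; apply/allP => i _ //=.
  by apply/implyP => ni; rewrite mxE /error_entry mulr0 addr0 eqxx mulr1.
move=> j x y; rewrite -error_entry00 !mxE (_ : f j == i0 = false) ?andbF //.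
by apply: contraNF i0f => /eqP <-; exact: codom_f.
Qed.

Local Close Scope ring_scope.

Theorem theorem16 (R : realType) (F : finFieldType) (q n : nat)
    (t z : nat -> nat)
    (hq : #|F| = q)
    (hn : (1 < n)%N) (hodd : odd n) (hcop : coprime n q)
    (hp : forall p, p \in primes n -> (p%:Z = -1 %[mod 4])%Z)
    (ht : forall p, p \in primes n -> is_mult_order p (q ^ 2) (t p))
    (hz : forall p, p \in primes n ->
       exactly_divides p (z p) (q ^ (2 * t p) - 1))
    (hm : forall p, p \in primes n -> (2 * z p < logn p n)%N) :
  exists (Q : {vspace qspace R 'rV[F]_n}) (P : 'End(qspace R 'rV[F]_n))
         (d d' : nat),
    [/\ is_quantum_code 1 d Q P,
        degenerate P d,
        pure_to P d',
        (d' <= min_over_primes n (fun p => p ^ z p) < d)%N &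
        (n <= d ^ 2 - d + 1)%N].
Proof.
have n_gt0 := ltnW hn; set p := pdiv n.
have pn : p \in primes n by rewrite mem_primes pdiv_prime // n_gt0 pdiv_dvd.
have pr_p : prime p by exact: pdiv_prime.
have q_gt0 : (0 < q)%N by rewrite -hq; apply/card_gt0P; exists 0%R.
have z_gt0 := exactly_divides_gt0 q_gt0 (ht p pn) (hz p pn).
have pX k : (k <= logn p n)%N -> (p ^ k %| n)%N by move=> kn; rewrite pfactor_dvdn.
have p3n : (p ^ 3 %| n)%N by apply: pX; have := hm p pn; lia.
(* Taken at n - 1, so that 5m^2 < n leaves room for at least one ancilla. *)
have [|m m_gt0 /andP[m5 mn]] := @five_square_interval n.-1.
  by case: (odd_multiple_of_cube hodd pr_p p3n) => [->|]; [left | right; lia].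
have [chi [chiD chiJ chi1]] := additive_character (Cplx R) F.
case: m m_gt0 m5 mn => // m _ m5 mn.
have code := concat_shift_code (ltn0Sn m) (ltn0Sn 2) (@shor_code (Cplx R) F m)
  (pentagon_code chiD chiJ chi1).
have [||Q [P [d [Qcode Pdeg md]]]] := @degenerate_quantum_code R F n _ _ _ _ _ code.
- by rewrite mulnC; lia.
- by rewrite !card_prod !card_ord; lia.
(* With d' = 0, no weight lies strictly between 0 and d'. *)
exists Q, P, d, 0%N; split=> //; last by nia.
  by move=> a b; rewrite ltn0 andbF.
have nd : (n <= d ^ 2)%N by nia.
rewrite leq0n /=; apply: leq_ltn_trans (min_over_primes_le _ pn) _.
(* Comparison of squares: p^(2z) < p^(2z+1) <= n <= d^2. *)
rewrite -(ltn_exp2r _ _ (isT : 0 < 2)) -expnM; apply: leq_trans nd.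
apply: leq_trans (dvdn_leq n_gt0 (pX _ (hm p pn))).
by rewrite ltn_exp2l ?prime_gt1 // mulnC.
Qed.
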